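(* Let $R/I$ be a level algebra of codimension three whose Betti diagram is a non-negative linear combination of pure diagrams, and let $c$ be the degree of its $h$-vector $h(t)$. Write $(1-t)^3h(t)=\sum_{i=0}^{c+3}\Delta^3h_i\,t^i$ and put $n_1=\min\{i:\Delta^3h_i<0\}$, $n_2=\min\{i>0:\Delta^3h_i>0\}$, $N_1=\max\{i\le c+1:\Delta^3h_i<0\}$, $N_2=\max\{i:\Delta^3h_i>0\}$. Then $$\frac{1}{3!}n_1n_2(c+3)\le e(R/I)\le\frac1{3!}N_1N_2(c+3),$$ and hence also $$\frac{\underline d_1\underline d_2\underline d_3}{3!}\le e(R/I)\le\frac{\overline d_1\overline d_2\overline d_3}{3!},$$ where $\underline d_i$ and $\overline d_i$ are the minimal and maximal shifts of $R/I$.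
   Context: $k$ is a field, $R=k[x_1,\dots,x_n]$ is standard graded, $I$ is a homogeneous ideal. $\beta_{i,j}(M)=\dim_k\operatorname{Tor}^R_i(M,k)_j$; the matrix $\beta(M)=(\beta_{i,j}(M))$ is the Betti diagram. For a Cohen-Macaulay module $M$ of codimension $p$, the $h$-vector is $h_M(t)=\big(\sum_{i,j}(-1)^i\beta_{i,j}(M)t^j\big)/(1-t)^p$ and $e(M)=h_M(1)$. The minimal and maximal shifts are $\underline d_i=\min\{j:\beta_{i,j}(M)\neq0\}$, $\overline d_i=\max\{j:\beta_{i,j}(M)\ne0\}$. $M$ of codimension $p$ is level if it is Cohen-Macaulay, $\underline d_0=\overline d_0$ and $\underline d_p=\overline d_p$. A diagram of codimension $p$ is a matrix $D=(D_{i,j})_{i,j\in\mathbb{Z}}$ of rational numbers with finitely many nonzero entries, with $D_{i,j}=0$ unless $0\le i\le p$, such that $\sum_{i,j}(-1)^iD_{i,j}t^j$ is divisible by $(1-t)^p$ in $\mathbb{Q}[t,t^{-1}]$. For a strictly increasing integer sequence $d=(d_0,\dots,d_p)$, the pure diagram $\pi(d)$ is the unique diagram of codimension $p$ with $\pi(d)_{i,j}=0$ whenever $j\ne d_i$ and $\pi(d)_{0,d_0}=1$. A non-negative linear combination of pure diagrams is a finite sum $\sum_da_d\pi(d)$ with $a_d\in\mathbb{Q}_{\ge0}$. *)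

(* Defs.v *)
From HB Require Import structures.
From mathcomp Require Import all_boot all_order all_algebra.
From mathcomp Require Export ring_quotient.
From mathcomp Require Export mpoly.

Set Implicit Arguments.
Unset Strict Implicit.
Unset Printing Implicit Defensive.

Import Order.TTheory GRing.Theory Num.Theory.
Local Open Scope ring_scope.

Definition is_min {disp} {T : porderType disp} (P : T -> Prop) (m : T) : Prop :=
  P m /\ forall x, P x -> (m <= x)%O.

Definition is_max {disp} {T : porderType disp} (P : T -> Prop) (m : T) : Prop :=
  P m /\ forall x, P x -> (x <= m)%O.

Section Algebra.
Variables (k : fieldType) (n : nat).
Local Notation R := {mpoly k[n]}.
Implicit Types (I : {pred R}).

Definition homogeneous_ideal I : Prop :=
  idealr_closed I /\
  forall f (d : nat), f \in I -> pihomog (@mdeg n) d f \in I.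

Definition is_prime I : Prop := idealr_closed I /\ prime_idealr_closed I.

(* A chain P_0 < ... < P_l of l + 1 primes containing I. *)
Definition prime_chain I (l : nat) : Prop :=
  exists P : 'I_l.+1 -> {pred R},
    (forall i, is_prime (P i) /\ {subset I <= P i}) /\
    (forall i j : 'I_l.+1, (i < j)%N ->
       {subset P i <= P j} /\ exists2 f, f \in P j & f \notin P i).

(* The Krull dimension of R/I is d. *)
Definition krull_dim I (d : nat) : Prop := is_max (prime_chain I) d.

(* The codimension dim R - dim R/I of R/I is p. *)
Definition codim I (p : nat) : Prop :=
  exists D d, [/\ krull_dim (pred1 (0 : R)) D, krull_dim I d & D = (d + p)%N].

(* g lies in the ideal I + (s_0, s_1, ...). *)
Definition in_ideal_add I (s : seq R) (g : R) : Prop :=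
  exists c : nat -> R, g - \sum_(i < size s) c i * s`_i \in I.

Definition regular_seq I (s : seq R) : Prop :=
  (forall j, (j < size s)%N -> forall g,
     in_ideal_add I (take j s) (s`_j * g) -> in_ideal_add I (take j s) g)
  /\ ~ in_ideal_add I s 1.

(* The depth of R/I with respect to the ideal (x_1, ..., x_n). *)
Definition depth I (d : nat) : Prop :=
  is_max (fun l => exists s : seq R,
    [/\ size s = l, all (fun f => f@_0%MM == 0) s & regular_seq I s]) d.

Definition cohen_macaulay I : Prop := exists2 d, krull_dim I d & depth I d.

(* Homogeneous of a possibly negative degree. *)
Definition homogz (e : int) (f : R) : bool :=
  if e is Posz d then f \is d.-homog else f == 0.

(* The graded free modules F_i = \bigoplus_a R(- shift i a), with elements
   written as row vectors; diff i : F_(i+1) -> F_i acts by right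
   multiplication and aug : F_0 -> R. *)
Record free_complex := FreeComplex {
  frank : nat -> nat;
  shift : forall i, 'I_(frank i) -> int;
  diff : forall i, 'M[R]_(frank i.+1, frank i);
  aug : 'cV[R]_(frank 0)
}.

(* ... -> F_1 -> F_0 -> R/I -> 0 is exact with maps of degree 0. *)
Definition graded_resolution I (F : free_complex) : Prop :=
  [/\ (forall a, homogz (shift a) (aug F a 0)),
      (forall i a b, homogz (shift a - shift b) (diff F i a b)),
      (exists v : 'rV[R]_(frank F 0), (v *m aug F) 0 0 - 1 \in I),
      (forall v : 'rV[R]_(frank F 0), (v *m aug F) 0 0 \in I <->
         exists w : 'rV[R]_(frank F 1), v = w *m diff F 0)
    & (forall i (v : 'rV[R]_(frank F i.+1)), v *m diff F i = 0 <->
         exists w : 'rV[R]_(frank F i.+2), v = w *m diff F i.+1)].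

(* The differentials of F (x)_R k, where k = R/(x_1, ..., x_n). *)
Definition diffk (F : free_complex) i : 'M[k]_(frank F i.+1, frank F i) :=
  map_mx (mcoeff 0%MM) (diff F i).

(* Its row space is the degree j part of F_i (x)_R k. *)
Definition degree_part (F : free_complex) i (j : int) : 'M[k]_(frank F i) :=
  \matrix_(a, b) ((a == b) && (shift a == j))%:R.

Definition cycles (F : free_complex) i (j : int) : 'M[k]_(frank F i) :=
  match i with
  | 0 => degree_part F 0 j
  | i'.+1 => (degree_part F i'.+1 j :&: kermx (diffk F i'))%MS
  end.

Definition boundaries (F : free_complex) i (j : int) :
    'M[k]_(frank F i.+1, frank F i) :=
  degree_part F i.+1 j *m diffk F i.

(* dim_k H_i(F (x)_R k)_j *)
Definition tor_dim (F : free_complex) i (j : int) : nat :=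
  (\rank (cycles F i j) - \rank (boundaries F i j))%N.

(* beta_(i,j) = dim_k Tor_i^R(R/I, k)_j, Tor being computed from a graded free
   resolution of R/I. *)
Definition betti_diagram I (beta : nat -> int -> nat) : Prop :=
  exists2 F, graded_resolution I F & forall i j, beta i j = tor_dim F i j.

Definition min_shift (beta : nat -> int -> nat) (i : nat) (d : int) : Prop :=
  is_min (fun j => beta i j <> 0%N) d.

Definition max_shift (beta : nat -> int -> nat) (i : nat) (d : int) : Prop :=
  is_max (fun j => beta i j <> 0%N) d.

(* R/I, with Betti diagram beta, is level of codimension p. *)
Definition level I (beta : nat -> int -> nat) (p : nat) : Prop :=
  [/\ cohen_macaulay I, codim I p,
      (exists2 d, min_shift beta 0 d & max_shift beta 0 d)
    & (exists2 d, min_shift beta p d & max_shift beta p d)].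

End Algebra.

(* Rows are indexed by nat: every diagram considered vanishes in negative
   homological degrees. *)
Definition diagram := nat -> int -> rat.

(* Coefficient of t^j in \sum_(i, l) (-1)^i D_(i,l) t^l, for D vanishing in
   rows i >= N. *)
Definition alt_coef (N : nat) (D : diagram) (j : int) : rat :=
  \sum_(i < N) (-1) ^+ i * D i j.

(* Elements of Q[t, t^-1] are finitely supported functions int -> rat; the
   equation below says P = q * Q in Q[t, t^-1]. *)
Definition laurent_dvd (q : {poly rat}) (P : int -> rat) : Prop :=
  exists2 Q : int -> rat,
    exists s : seq int, forall j, Q j != 0 -> j \in s
  & forall j, P j = \sum_(l < size q) q`_l * Q (j - l%:Z).

Definition is_diagram (p : nat) (D : diagram) : Prop :=
  [/\ (exists s : seq int, forall i j, D i j != 0 -> j \in s),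
      (forall i j, (p < i)%N -> D i j = 0)
    & laurent_dvd ((1 - 'X) ^+ p) (alt_coef p.+1 D)].

(* D = pi(d), for d strictly increasing of length p + 1. *)
Definition pure_diagram (p : nat) (d : (p.+1).-tuple int) (D : diagram) : Prop :=
  [/\ is_diagram p D,
      (forall i j, (i <= p)%N -> j != d`_i -> D i j = 0)
    & D 0%N d`_0 = 1].

Definition nonneg_pure_comb (p : nat) (D : diagram) : Prop :=
  exists (m : nat) (a : 'I_m -> rat) (d : 'I_m -> (p.+1).-tuple int)
         (pi : 'I_m -> diagram),
    (forall u, [/\ 0 <= a u, sorted <%R (d u) & pure_diagram (d u) (pi u)]) /\
    (forall i j, D i j = \sum_(u < m) a u * pi u i j).

(* (1 - t)^p h(t) = \sum_(i, j) (-1)^i D_(i,j) t^j.  For D the Betti diagram of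
   R/I the right-hand side has no negative powers of t, so h is a polynomial. *)
Definition is_h_vector (p : nat) (D : diagram) (h : {poly rat}) : Prop :=
  exists2 N, (forall i j, (N <= i)%N -> D i j = 0)
  & forall j : int,
      (if j is Posz m then ((1 - 'X) ^+ p * h)`_m else 0) = alt_coef N D j.

Definition multiplicity (h : {poly rat}) : rat := h.[1].

(* Main.v *)
(* For a level algebra every pure diagram occurring with a positive coefficient
   a_u has the form pi(0, x_u, y_u, s) with the same s = c + 3, and since
   beta_(0,0) = 1 the a_u sum to 1.  Pairing the Betti diagram with a function
   (s - j) mu(j) of the degree, mu(0) = 0, gives
     \sum_j Delta^3 h_j (s - j) mu(j)
       = s \sum_u a_u (x_u mu(y_u) - y_u mu(x_u)) / (y_u - x_u).
   For mu(j) = j^2 this reads 6 e = s \sum_u a_u x_u y_u, which yields the bounds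
   by the shifts.  The entries in the degrees min x_u and max y_u do not cancel in
   Delta^3 h, so n_1 <= x_u and y_u <= N_2, whereas n_2 and N_1 may be affected
   by cancellation.  Taking for mu the positive part of (j - A)(B - j), with
   (A, B) = (n_1, n_2) or (N_1, N_2), the right-hand side is at least
   s A B - 6 e, respectively at most s A B - 6 e, while the left-hand side only
   sees A < j < B, where Delta^3 h is <= 0, respectively >= 0. *)
Require Import Defs.
From HB Require Import structures.
From mathcomp Require Import all_boot all_order all_algebra.
From mathcomp Require Import zify ring lra.
Import Order.TTheory GRing.Theory Num.Theory.
Local Open Scope ring_scope.

(** * Row zero of the Betti diagram of a cyclic graded module *)

Section TorZero.
Variables (k : fieldType) (n : nat) (I : {pred {mpoly k[n]}}).
Variable F : free_complex k n.
Hypothesis hI : homogeneous_ideal I.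
Hypothesis hF : graded_resolution I F.

Let const_term : {rmorphism {mpoly k[n]} -> k} := mcoeff 0%MM.
Let augk : 'cV[k]_(frank F 0) := map_mx const_term (aug F).

Lemma homogz_const_term (e : int) (f : {mpoly k[n]}) :
  homogz e f -> f@_0%MM != 0 -> e = 0.
Proof.
case: e => [d|d] /=; last by move/eqP->; rewrite mcoeff0 eqxx.
move=> /dhomogP hd h0; congr Posz.
have /hd <- : 0%MM \in msupp f by rewrite mcoeff_msupp.
exact: mdeg0.
Qed.

(** Homogeneity puts the degree 0 part of [f], its constant term, into [I]. Were it nonzero, it
    would be a unit and [I] would contain 1. *)
Lemma proper_const_term (f : {mpoly k[n]}) : f \in I -> f@_0%MM = 0.
Proof.
move=> fI; have [[I0 h1 idl] hom] := hI.
apply/eqP; apply: contraNT h1 => f0.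
have := idl (f@_0%MM)^-1%:MP_[n] _ _ (hom f 0%N fI) I0.
rewrite addr0.
suff -> : pihomog (@mdeg n) 0 f = (f@_0%MM)%:MP_[n] by rewrite -mpolyCM mulVf.
rewrite pihomogE (eq_bigl (pred1 0%MM)) => [|m /=]; last by rewrite mdeg_eq0.
rewrite -big_filter (perm_big [:: 0%MM]) ?big_seq1 ?mpolyX0 ?alg_mpolyC //.
apply: uniq_perm; rewrite ?filter_uniq ?msupp_uniq // => m.
rewrite mem_filter mcoeff_msupp /=.
case: eqP => [->|/eqP/negPf ne]; first by rewrite mem_seq1 eqxx; exact: f0.
by rewrite mem_seq1 ne.
Qed.

(** A homogeneous entry has a nonzero constant term only if its degree is 0, that is, only between
    generators of equal shift. Hence reduction modulo the variables leaves a map that respects the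
    degree parts. *)
Lemma diffk_degree_part (i : nat) (j : int) :
  degree_part F i.+1 j *m diffk F i = diffk F i *m degree_part F i j.
Proof.
case: hF => _ hom _ _ _.
apply/matrixP => a b; rewrite !mxE.
rewrite (bigD1 a) //= big1 ?addr0 => [|c ca]; last by rewrite !mxE eq_sym (negPf ca) mul0r.
rewrite (bigD1 b) //= big1 ?addr0 => [|c cb]; last by rewrite !mxE (negPf cb) mulr0.
rewrite !mxE !eqxx /= mulrC.
have [->|nz] := eqVneq ((diff F i a b)@_0%MM) 0; first by rewrite !mul0r.
by have /eqP := homogz_const_term _ _ (hom i a b) nz; rewrite subr_eq0 => /eqP ->.
Qed.

Lemma degree_part_augk (j : int) : degree_part F 0 j *m augk = (j == 0)%:R *: augk.
Proof.
case: hF => hom _ _ _ _.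
apply/matrixP => a b; rewrite !mxE.
rewrite (bigD1 a) //= big1 ?addr0 => [|c ca]; last by rewrite !mxE eq_sym (negPf ca) mul0r.
rewrite !mxE !eqxx /= ord1.
have [->|nz] := eqVneq (const_term (aug F a 0)) 0; first by rewrite !mulr0.
by rewrite (homogz_const_term _ _ (hom a) nz) eq_sym.
Qed.

Lemma diffk_augk : diffk F 0 *m augk = 0.
Proof.
case: hF => _ _ _ ex0 _.
apply/row_matrixP => i; rewrite row0 row_mul.
apply/rowP => z; rewrite ord1.
have /ex0 : exists w, row i (diff F 0) = w *m diff F 0 by exists (delta_mx 0 i); rewrite -rowE.
move/(proper_const_term _); rewrite -map_row /augk.
have -> : map_mx (mcoeff 0%MM) (row i (diff F 0)) = map_mx const_term (row i (diff F 0)) by [].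
by rewrite -map_mxM /= !mxE.
Qed.

(** Right exactness of the tensor product at the zeroth spot. A kernel vector [u] is lifted to
    constants [U], whose image [f] has no constant term. Subtracting [f *: v0], where [v0] maps to 1
    modulo [I], moves the image into [I] without changing the reduction [u], so exactness of the
    resolution applies. *)
Lemma kermx_augk_sub : (kermx augk <= diffk F 0)%MS.
Proof.
case: hF => _ _ [v0 hv0] ex0 _.
apply/row_subP => i; set u := row i _.
have hu : u *m augk = 0 by apply/sub_kermxP; exact: row_sub.
pose U : 'rV[{mpoly k[n]}]_(frank F 0) := map_mx (@mpolyC n k) u.
pose f := (U *m aug F) 0 0.
have hUk : map_mx const_term U = u.
  by apply/rowP => z; rewrite !mxE /= mcoeffC eqxx mulr1.
have f0 : const_term f = 0.
  have <- : map_mx const_term (U *m aug F) 0 0 = const_term f by rewrite mxE.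
  by rewrite map_mxM hUk hu mxE.
have [[I0 _ idl] _] := hI.
have : ((U - f *: v0) *m aug F) 0 0 \in I.
  rewrite mulmxBl -scalemxAl mxE [X in _ + X]mxE [X in - X]mxE -/f.
  have -> : f - f * (v0 *m aug F) 0 0 = (- f) * ((v0 *m aug F) 0 0 - 1) + 0.
    by rewrite addr0 mulrBr mulr1 opprK mulNr addrC.
  exact: idl.
move/ex0 => [w hw].
have : map_mx const_term (U - f *: v0) = map_mx const_term w *m diffk F 0.
  by rewrite hw map_mxM.
rewrite map_mxB map_mxZ f0 scale0r subr0 hUk => ->.
exact: submxMl.
Qed.

Lemma rank_augk : \rank augk = 1%N.
Proof.
case: hF => _ _ [v0 hv0] _ _.
apply/eqP; rewrite eqn_leq rank_leq_col lt0n mxrank_eq0.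
apply/eqP => a0.
have := proper_const_term _ hv0.
have h : const_term ((v0 *m aug F) 0 0) = 0.
  have <- : map_mx const_term (v0 *m aug F) 0 0 = const_term ((v0 *m aug F) 0 0).
    by rewrite mxE.
  by rewrite map_mxM -/augk a0 mulmx0 mxE.
rewrite mcoeffB mcoeff1 eqxx [X in X - _]h sub0r.
by move/eqP; rewrite oppr_eq0 oner_eq0.
Qed.

Lemma tor_dim0 (j : int) : tor_dim F 0 j = (j == 0).
Proof.
rewrite /tor_dim /= /boundaries diffk_degree_part.
set P := degree_part F 0 j.
have idP : P *m P = P.
  apply/matrixP => a b; rewrite !mxE.
  rewrite (bigD1 a) //= big1 ?addr0 => [|c ca]; last by rewrite !mxE eq_sym (negPf ca) mul0r.
  by rewrite !mxE eqxx /=; case: (shift a == j); rewrite ?andbF ?mul1r ?mul0r.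
(* The boundaries in degree [j] are the kernel of [augk] on the degree part, so by rank-nullity the
   Tor dimension is the rank of [P *m augk]. *)
have kerP : (P :&: kermx augk :=: diffk F 0 *m P)%MS.
  apply/eqmxP/andP; split; last first.
    rewrite sub_capmx submxMl /=; apply/sub_kermxP.
    by rewrite -mulmxA degree_part_augk -scalemxAr diffk_augk // scaler0.
  have subP : (P :&: kermx augk <= P)%MS by exact: capmxSl.
  have <- : (P :&: kermx augk)%MS *m P = (P :&: kermx augk)%MS.
    by have /submxP [w ->] := subP; rewrite -mulmxA idP.
  apply: submxMr.
  exact: submx_trans (capmxSr _ _) kermx_augk_sub.
rewrite -kerP -(mxrank_mul_ker P augk) addnK degree_part_augk.
case: eqP => _; first by rewrite scale1r rank_augk.
by rewrite scale0r mxrank0.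
Qed.

End TorZero.

(** * Pairing Laurent polynomials with functions of the degree *)

Lemma sum_over_support (T : eqType) (V : nmodType) (g : T -> V) (s s' : seq T) :
  uniq s -> uniq s' ->
  (forall j, g j != 0 -> j \in s) -> (forall j, g j != 0 -> j \in s') ->
  \sum_(j <- s) g j = \sum_(j <- s') g j.
Proof.
move=> us us' hs hs'.
rewrite (bigID (fun j => g j != 0)) /= [X in _ + X]big1 ?addr0 => [|i]; last first.
  by rewrite negbK => /eqP.
rewrite [RHS](bigID (fun j => g j != 0)) /= [X in _ = _ + X]big1 ?addr0 => [|i]; last first.
  by rewrite negbK => /eqP.
rewrite -big_filter -[RHS]big_filter; apply: perm_big.
apply: uniq_perm; rewrite ?filter_uniq // => j; rewrite !mem_filter.
by case: (boolP (g j != 0)) => //= gj; rewrite hs ?hs'.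
Qed.

(** Multiplication by [q] is moved from [Q] to its adjoint difference operator on [f]. For [q] the
    cube of [1 - 'X] this operator is minus the third forward difference. *)
Lemma laurent_pairing (q : {poly rat}) (P Q f : int -> rat) (s T : seq int) :
  uniq s -> uniq T ->
  (forall j, Q j != 0 -> j \in s) -> (forall j, P j != 0 -> j \in T) ->
  (forall j, P j = \sum_(l < size q) q`_l * Q (j - l%:Z)) ->
  \sum_(j <- T) P j * f j =
  \sum_(x <- s) Q x * \sum_(l < size q) q`_l * f (x + l%:Z).
Proof.
move=> us uT hQ hP PE.
(* A common range containing [T] and every shift of [s], so that the two sums can be exchanged and
   reindexed. *)
pose T' := undup (T ++ flatten [seq [seq x + (val l)%:Z | x <- s] | l <- enum 'I_(size q)]).
have memT' (l : 'I_(size q)) x : x \in s -> x + l%:Z \in T'.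
  move=> xs; rewrite mem_undup mem_cat; apply/orP; right; apply/flattenP.
  exists [seq x + (val l)%:Z | x <- s]; last exact: map_f.
  by apply: map_f; rewrite mem_enum.
rewrite (@sum_over_support _ _ _ T T') ?undup_uniq //; first last.
- move=> j; rewrite mulf_eq0 negb_or => /andP [/hP h _].
  by rewrite mem_undup mem_cat h.
- by move=> j; rewrite mulf_eq0 negb_or => /andP [/hP].
under eq_bigr do rewrite PE mulr_suml.
under [RHS]eq_bigr do rewrite mulr_sumr.
rewrite exchange_big [RHS]exchange_big /=; apply: eq_bigr => l _.
pose g x := Q x * (q`_l * f (x + l%:Z)).
transitivity (\sum_(x <- [seq j - l%:Z | j <- T']) g x).
  by rewrite big_map; apply: eq_bigr => j _; rewrite /g subrK mulrCA mulrA.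
apply: sum_over_support => //.
- by rewrite map_inj_uniq ?undup_uniq //; exact: addIr.
- move=> x; rewrite mulf_eq0 negb_or => /andP [/hQ xs _].
  by apply/mapP; exists (x + l%:Z); rewrite ?memT' ?addrK.
- by move=> x; rewrite mulf_eq0 negb_or => /andP [/hQ].
Qed.

Lemma polyseq_1subX3 :
  (1 - 'X) ^+ 3 = [:: 1; - 3%:R; 3%:R; -1] :> seq rat.
Proof.
have -> : (1 - 'X) ^+ 3 = Poly [:: 1; - 3%:R; 3%:R; -1] :> {poly rat}.
  apply: (@eq_trans _ _ (1 - 3%:R *: 'X + 3%:R *: 'X ^+ 2 - 'X ^+ 3)).
    by rewrite -!mul_polyC !rmorph_nat; ring.
  by apply/polyP => -[|[|[|[|i]]]]; rewrite coef_Poly !coefE /= ?nth_nil; field.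
by rewrite (PolyK (c := 0)).
Qed.

Lemma sum_coef_1subX3 (g : nat -> rat) :
  \sum_(l < size ((1 - 'X) ^+ 3 : {poly rat})) ((1 - 'X) ^+ 3)`_l * g l
  = g 0%N - 3%:R * g 1%N + 3%:R * g 2%N - g 3%N.
Proof. by rewrite polyseq_1subX3 /= !big_ord_recl big_ord0 /=; ring. Qed.

(** The bound on the rows in [is_h_vector] is only known to exist; this allows it to be replaced by
    4. *)
Lemma alt_coef_widen (M N : nat) (D : diagram) (j : int) :
  (forall i j, (M <= i)%N -> D i j = 0) -> (M <= N)%N ->
  alt_coef N D j = alt_coef M D j.
Proof.
move=> D0 MN; rewrite /alt_coef.
rewrite -!(big_mkord xpredT (fun i => (-1) ^+ i * D i j)).
rewrite (big_cat_nat (leq0n M) MN) /=.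
rewrite [X in _ + X]big_nat_cond [X in _ + X]big1 ?addr0 // => i /andP [/andP [Mi _] _].
by rewrite D0 ?mulr0.
Qed.

Lemma alt_coef4 (D : diagram) (j : int) :
  alt_coef 4 D j = D 0%N j - D 1%N j + D 2%N j - D 3%N j.
Proof. by rewrite /alt_coef !big_ord_recl big_ord0 /=; ring. Qed.

(** * Pure diagrams of codimension three *)

Section PureDiagram.
Variables (d : 4.-tuple int) (D : diagram).
Hypothesis dD : pure_diagram d D.
Hypothesis sd : sorted <%R d.

Let x (i : nat) : rat := (d`_i)%:~R.

Lemma pure_diagram_supp (i : nat) (j : int) :
  D i j = (D i d`_i) *+ ((i < 4)%N && (j == d`_i)).
Proof.
case: dD => -[_ D0 _] Dj _.
rewrite ltnS; have [i3|i3] := leqP i 3; last by rewrite D0.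
by have [->|ji] := eqVneq j d`_i; rewrite ?mulr1n //= Dj.
Qed.

(** The Herzog-Kühl equations: divisibility by the cube of [1 - 'X] makes the pairing vanish on
    every function with zero third difference. *)
Lemma pure_diagram_pairing (f : int -> rat) :
  (forall y, f y - 3%:R * f (y + 1) + 3%:R * f (y + 2) - f (y + 3) = 0) ->
  D 0%N d`_0 * f d`_0 - D 1%N d`_1 * f d`_1 + D 2%N d`_2 * f d`_2
    - D 3%N d`_3 * f d`_3 = 0.
Proof.
move=> hf; case: (dD) => -[_ D0 [Q [s hs] PE]] Dj _.
have ud : uniq d by apply: sorted_uniq sd; [exact: lt_trans | exact: ltxx].
have hP j : alt_coef 4 D j != 0 -> j \in (d : seq int).
  apply: contraNT => jd; rewrite alt_coef4.
  by rewrite !Dj ?subr0 ?addr0 //; apply: contraNneq jd => ->; rewrite mem_nth ?size_tuple.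
have := @laurent_pairing _ _ _ f (undup s) d (undup_uniq _) ud _ hP PE.
rewrite [RHS]big1 => [|y _]; last first.
  by rewrite (sum_coef_1subX3 (fun l => f (y + l%:Z))) addr0 hf mulr0.
move=> <- //; last by move=> j; rewrite mem_undup; exact: hs.
have sumD (i : nat) : (i < 4)%N -> \sum_(j <- d) D i j * f j = D i d`_i * f d`_i.
  move=> i4; rewrite (bigD1_seq d`_i) ?mem_nth ?size_tuple //= big1 ?addr0 // => j ji.
  by rewrite Dj ?mul0r.
rewrite -!sumD // -!sumrB -big_split -sumrB /=.
by apply: eq_bigr => j _; rewrite alt_coef4; ring.
Qed.

Lemma pure_diagram_lt (i : nat) : (i < 3)%N -> x i < x i.+1.
Proof.
move=> i3; rewrite /x ltr_int.
by move/(sortedP 0): sd; apply; rewrite size_tuple.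
Qed.

(** A quadratic vanishing at two of the last three degrees isolates the entry at the third, in terms
    of the entry 1 in row 0. *)
Lemma pure_diagram_formulas :
  [/\ D 1%N d`_1 = (x 2 - x 0) * (x 3 - x 0) / ((x 2 - x 1) * (x 3 - x 1)),
      D 2%N d`_2 = (x 1 - x 0) * (x 3 - x 0) / ((x 2 - x 1) * (x 3 - x 2))
    & D 3%N d`_3 = (x 1 - x 0) * (x 2 - x 0) / ((x 3 - x 1) * (x 3 - x 2))].
Proof.
have l0 := pure_diagram_lt 0 isT; have l1 := pure_diagram_lt 1 isT.
have l2 := pure_diagram_lt 2 isT.
have quad (a b : rat) := @pure_diagram_pairing (fun j => (j%:~R - a) * (j%:~R - b)).
have D0 : D 0%N d`_0 = 1 by case: dD.
have {}quad a b : (x 0 - a) * (x 0 - b) - D 1%N d`_1 * ((x 1 - a) * (x 1 - b))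
    + D 2%N d`_2 * ((x 2 - a) * (x 2 - b)) - D 3%N d`_3 * ((x 3 - a) * (x 3 - b)) = 0.
  by rewrite -[RHS](quad a b) ?D0 ?mul1r // => y; rewrite !rmorphD /=; ring.
split.
- have := quad (x 2) (x 3) => e; apply: (canRL (mulfK _)); first by nra.
  lra.
- have := quad (x 1) (x 3) => e; apply: (canRL (mulfK _)); first by nra.
  lra.
- have := quad (x 1) (x 2) => e; apply: (canRL (mulfK _)); first by nra.
  lra.
Qed.

End PureDiagram.

(** * Level diagrams as combinations of pure diagrams *)

(** All entries of pure diagrams are nonnegative, so nothing cancels within a row: the concentration
    of rows 0 and 3 of [D] forces the first and last degree of each diagram with positive
    coefficient. Diagrams with coefficient 0 are unconstrained, hence the restricted sums. *)
Lemma level_pure_decomposition (D : diagram) (s : int) :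
  nonneg_pure_comb 3 D ->
  (forall j, D 0%N j = (j == 0)%:R) -> (forall j, D 3%N j != 0 -> j = s) ->
  exists (m : nat) (a : 'I_m -> rat) (x y : 'I_m -> int),
    [/\ forall u, 0 < a u -> [/\ 0 < x u, x u < y u & y u < s],
        \sum_(u | 0 < a u) a u = 1,
        forall i j, (3 < i)%N -> D i j = 0,
        forall j, D 1%N j = \sum_(u | 0 < a u)
          a u * ((y u)%:~R * s%:~R
                 / ((y u - x u)%:~R * (s - x u)%:~R)) *+ (j == x u)
      & forall j, D 2%N j = \sum_(u | 0 < a u)
          a u * ((x u)%:~R * s%:~R
                 / ((y u - x u)%:~R * (s - y u)%:~R)) *+ (j == y u)].
Proof.
move=> [m [a [d [pi [hu DE]]]]] D0 D3.
have a0 u : 0 <= a u by case: (hu u).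
have sd u : sorted <%R (d u) by case: (hu u).
have pd u : pure_diagram (d u) (pi u) by case: (hu u).
have {}DE i j : D i j = \sum_(u | 0 < a u) a u * pi u i j.
  rewrite DE (bigID (fun u => 0 < a u)) /= [X in _ + X]big1 ?addr0 // => u.
  by rewrite lt0r a0 andbT negbK => /eqP->; rewrite mul0r.
have lt01 u : (d u)`_0 < (d u)`_1 by move/(sortedP 0): (sd u); apply; rewrite size_tuple.
have lt12 u : (d u)`_1 < (d u)`_2 by move/(sortedP 0): (sd u); apply; rewrite size_tuple.
have lt23 u : (d u)`_2 < (d u)`_3 by move/(sortedP 0): (sd u); apply; rewrite size_tuple.
have pi0 u : pi u 0%N (d u)`_0 = 1 by case: (pd u).
have pi3 u : 0 < pi u 3%N (d u)`_3.
  case: (pure_diagram_formulas _ _ (pd u) (sd u)) => _ _ ->.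
  by rewrite divr_gt0 ?mulr_gt0 // subr_gt0 ltr_int; move: (lt01 u) (lt12 u) (lt23 u); lia.
(* A positive term at its own degree cannot be cancelled by the other, nonnegative, terms of the
   same row. *)
have supp u i : 0 < a u -> 0 < pi u i (d u)`_i ->
    (forall v, 0 <= pi v i (d v)`_i) -> D i (d u)`_i != 0.
  move=> au piu pos; apply: lt0r_neq0; rewrite DE (bigD1 u) //=.
  apply: ltr_pwDl; first by rewrite mulr_gt0.
  apply: sumr_ge0 => v /andP [av _]; rewrite mulr_ge0 //.
  by rewrite (pure_diagram_supp _ _ (pd v)); case: (_ && _); rewrite ?mulr1n.
have du0 u : 0 < a u -> (d u)`_0 = 0.
  move=> au; have := supp u 0%N au; rewrite pi0 D0 => /(_ ltr01).
  move=> /(_ (fun v => ltW (eq_ind_r (fun z => 0 < z) ltr01 (pi0 v)))).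
  by rewrite pnatr_eq0 eqb0 negbK => /eqP.
have du3 u : 0 < a u -> (d u)`_3 = s.
  by move=> au; apply: D3; apply: supp => // v; exact: ltW.
exists m, a, (fun u => (d u)`_1), (fun u => (d u)`_2); split.
- by move=> u au; move: (lt01 u) (lt12 u) (lt23 u); rewrite du0 // du3.
- have := DE 0%N 0; rewrite D0 eqxx -[true%:R]/1 => ->; apply: eq_bigr => u au.
  by have := pi0 u; rewrite du0 // => ->; rewrite mulr1.
- move=> i j i3; rewrite DE big1 // => u _.
  by rewrite (pure_diagram_supp _ _ (pd u)) ltnS leqNgt i3 mulr0n mulr0.
- move=> j; rewrite DE; apply: eq_bigr => u au.
  rewrite (pure_diagram_supp _ _ (pd u)) /= mulrnAr; congr (_ * _ *+ _).
  case: (pure_diagram_formulas _ _ (pd u) (sd u)) => -> _ _.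
  by rewrite du0 // du3 // !subr0 !rmorphB.
- move=> j; rewrite DE; apply: eq_bigr => u au.
  rewrite (pure_diagram_supp _ _ (pd u)) /= mulrnAr; congr (_ * _ *+ _).
  case: (pure_diagram_formulas _ _ (pd u) (sd u)) => _ -> _.
  by rewrite du0 // du3 // !subr0 !rmorphB.
Qed.

(** The condition on [f] holds for cubics with leading coefficient -1, such as [(s - j) * j ^+ 2].
    The adjoint operator turns them into the constant 6, so only the coefficient sum of [h]
    remains. *)
Lemma h_vector_cubic_pairing (h : {poly rat}) (P f : int -> rat) (T : seq int) :
  uniq T -> (forall j, P j != 0 -> j \in T) ->
  (forall j : int, (if j is Posz m then ((1 - 'X) ^+ 3 * h)`_m else 0) = P j) ->
  (forall z, f z - 3%:R * f (z + 1) + 3%:R * f (z + 2) - f (z + 3) = 6%:R) ->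
  \sum_(j <- T) P j * f j = 6%:R * h.[1].
Proof.
move=> uT PT hP hf.
pose Q (j : int) := if j is Posz m then h`_m else 0.
have us : uniq [seq Posz i | i <- iota 0 (size h)].
  by rewrite map_inj_uniq ?iota_uniq // => i j [].
have hQ j : Q j != 0 -> j \in [seq Posz i | i <- iota 0 (size h)].
  case: j => [i|i] //=.
  move=> hi; apply: map_f; rewrite mem_iota /=.
  by rewrite ltnNge; apply: contraNN hi => hi; rewrite nth_default.
rewrite (@laurent_pairing ((1 - 'X) ^+ 3) P Q f _ T us uT hQ PT); last first.
  move=> j; rewrite (sum_coef_1subX3 (fun l => Q (j - l%:Z))) -hP.
  have -> : (1 - 'X) ^+ 3 * h = h - 3%:R *: ('X^1 * h) + 3%:R *: ('X^2 * h) - 'X^3 * h.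
    by rewrite -!mul_polyC !rmorph_nat; ring.
  case: j => [i|i].
    rewrite !(coefD, coefN, coefZ, coefXnM) subr0.
    case: i => [|[|[|i]]] //=; rewrite ?subn0 //.
  (* In negative degrees every shift is again negative, where [Q] is 0. *)
  have N (l : nat) : Q (Negz i - l%:Z) = 0.
    by have -> : Negz i - l%:Z = Negz (i + l) by lia.
  by rewrite !N; ring.
rewrite big_map horner_coef mulr_sumr -(big_mkord xpredT (fun i => 6%:R * (h`_i * 1 ^+ i))).
rewrite /index_iota subn0; apply: eq_bigr => i _.
by rewrite (sum_coef_1subX3 (fun l => f (Posz i + l%:Z))) addr0 hf expr1n /= mulr1 mulrC.
Qed.

(* With [p z = (z - A) * (B - z)] one has
   [(y - x) * (x * y - A * B) = y * p x - x * p y]; [bump_weight] is the positive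
   part of [p], and both bounds below compare it with [p]. *)
Definition bump_weight (A B x : rat) : rat := Num.max 0 ((x - A) * (B - x)).

(** No order of [A] and [B] is assumed, so both orientations of the open interval occur. *)
Lemma bump_weight_gt0 (A B x : rat) :
  0 < bump_weight A B x -> A < x < B \/ B < x < A.
Proof.
rewrite /bump_weight lt_max ltxx /= => p.
have [xA|Ax|xA] := ltgtP x A; [right | left | by move: p; rewrite xA subrr mul0r ltxx].
  by rewrite andbT; nra.
by rewrite andTb; nra.
Qed.

(** If [x <= B], the weight agrees with [p] at [x] and is at least [p] at [y]. If [x > B], both
    weights vanish and [A * B <= x * y]. *)
Lemma bump_weight_lower (A B x y : rat) :
  0 <= A -> 0 <= B -> A <= x -> 0 < x -> x < y ->
  A * B - x * y <= (x * bump_weight A B y - y * bump_weight A B x) / (y - x).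
Proof.
move=> A0 B0 Ax x0 xy.
rewrite ler_pdivlMr ?subr_gt0 // /bump_weight.
have [xB|xB] := leP x B.
  rewrite [Num.max 0 ((x - A) * _)]max_r ?mulr_ge0 ?subr_ge0 //.
  have : x * ((y - A) * (B - y)) <= x * Num.max 0 ((y - A) * (B - y)).
    by rewrite ler_pM2l // le_max lexx orbT.
  lra.
rewrite !max_l ?mulr0 ?subr0; try nra.
have : A * B <= x * y by nra.
nra.
Qed.

(** If [A <= y], the weight agrees with [p] at [y] and is at least [p] at [x]. If [y < A], both
    weights vanish and [x * y <= A * B]. *)
Lemma bump_weight_upper (A B x y : rat) :
  0 <= A -> y <= B -> 0 < x -> x < y ->
  (x * bump_weight A B y - y * bump_weight A B x) / (y - x) <= A * B - x * y.
Proof.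
move=> A0 yB x0 xy.
rewrite ler_pdivrMr ?subr_gt0 // /bump_weight.
have [Ay|Ay] := leP A y.
  rewrite [Num.max 0 ((y - A) * _)]max_r ?mulr_ge0 ?subr_ge0 //.
  have : y * ((x - A) * (B - x)) <= y * Num.max 0 ((x - A) * (B - x)).
    by rewrite ler_pM2l ?(lt_trans x0) // le_max lexx orbT.
  lra.
rewrite !max_l ?mulr0 ?subr0; try nra.
have : x * y <= A * B by nra.
nra.
Qed.

(** The condition [mu 0 = 0] kills row 0 and the factor [s - j] kills row 3. In rows 1 and 2 the
    same factor cancels [s - x u] and [s - y u] in the denominators. *)
Lemma pure_combination_pairing (D : diagram) (s : int) (m : nat)
    (a : 'I_m -> rat) (x y : 'I_m -> int) (mu : int -> rat) (T : seq int) :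
  (forall u, 0 < a u -> [/\ 0 < x u, x u < y u & y u < s]) ->
  (forall j, D 0%N j = (j == 0)%:R) -> (forall j, D 3%N j != 0 -> j = s) ->
  (forall j, D 1%N j = \sum_(u | 0 < a u)
     a u * ((y u)%:~R * s%:~R
            / ((y u - x u)%:~R * (s - x u)%:~R)) *+ (j == x u)) ->
  (forall j, D 2%N j = \sum_(u | 0 < a u)
     a u * ((x u)%:~R * s%:~R
            / ((y u - x u)%:~R * (s - y u)%:~R)) *+ (j == y u)) ->
  uniq T -> (forall j, 0 < j < s -> j \in T) -> mu 0 = 0 ->
  \sum_(j <- T) alt_coef 4 D j * ((s - j)%:~R * mu j) =
  s%:~R * \sum_(u | 0 < a u) a u *
    (((x u)%:~R * mu (y u) - (y u)%:~R * mu (x u)) / ((y u)%:~R - (x u)%:~R)).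
Proof.
move=> hxy D0 D3 D1 D2 uT hT mu0.
have sumT (i : int) (g : int -> rat) (b : rat) : 0 < i < s ->
    \sum_(j <- T) b *+ (j == i) * g j = b * g i.
  move=> /hT iT; rewrite (bigD1_seq i) //= eqxx big1 ?addr0 // => j /negPf ->.
  by rewrite mulr0n mul0r.
pose f j := (s - j)%:~R * mu j.
transitivity (\sum_(j <- T) (D 2%N j * f j - D 1%N j * f j)).
  apply: eq_bigr => j _; rewrite alt_coef4 -/(f j).
  have f0 : D 0%N j * f j = 0.
    by rewrite D0; case: eqP => [->|_]; rewrite ?mul0r // /f mu0 !mulr0.
  have f3 : D 3%N j * f j = 0.
    have [->|/D3 ->] := eqVneq (D 3%N j) 0; first by rewrite mul0r.
    by rewrite /f subrr mul0r mulr0.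
  by rewrite mulrBl mulrDl mulrBl f0 f3; ring.
under eq_bigr do rewrite D1 D2 !mulr_suml -sumrB.
rewrite exchange_big mulr_sumr; apply: eq_bigr => u au.
have [x0 xy ys] := hxy u au.
have xr : 0 < x u < s by rewrite x0 (lt_trans xy).
have yr : 0 < y u < s by rewrite ys (lt_trans x0).
rewrite sumrB !sumT // /f.
have d1 : (y u)%:~R - (x u)%:~R != 0 :> rat by rewrite -rmorphB intr_eq0 subr_eq0 gt_eqF.
have d2 : s%:~R - (x u)%:~R != 0 :> rat.
  by rewrite -rmorphB intr_eq0 subr_eq0 gt_eqF // (lt_trans xy).
have d3 : s%:~R - (y u)%:~R != 0 :> rat by rewrite -rmorphB intr_eq0 subr_eq0 gt_eqF.
by rewrite !rmorphB /=; field; rewrite d1 d2 d3.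
Qed.

(** * The bounds on the multiplicity *)

Theorem corollary7p4 (k : fieldType) (n : nat) (I : {pred {mpoly k[n]}})
    (beta : nat -> int -> nat) (h : {poly rat}) (c : nat)
    (hI : homogeneous_ideal I)
    (hbeta : betti_diagram I beta)
    (hlevel : level I beta 3)
    (hpure : nonneg_pure_comb 3 (fun i j => (beta i j)%:R))
    (hh : is_h_vector 3 (fun i j => (beta i j)%:R) h)
    (hc : size h = c.+1) :
  let D3h := fun i : nat => ((1 - 'X) ^+ 3 * h)`_i in
  (forall n1 n2 N1 N2 : nat,
     is_min (fun i : nat => D3h i < 0) n1 ->
     is_min (fun i : nat => (0 < i)%N /\ 0 < D3h i) n2 ->
     is_max (fun i : nat => (i <= c + 1)%N /\ D3h i < 0) N1 ->
     is_max (fun i : nat => 0 < D3h i) N2 ->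
     (n1 * n2 * (c + 3))%:R / (3`!)%:R <= multiplicity h
       <= (N1 * N2 * (c + 3))%:R / (3`!)%:R)
  /\
  (forall l1 l2 l3 u1 u2 u3 : int,
     min_shift beta 1 l1 -> min_shift beta 2 l2 -> min_shift beta 3 l3 ->
     max_shift beta 1 u1 -> max_shift beta 2 u2 -> max_shift beta 3 u3 ->
     (l1 * l2 * l3)%:~R / (3`!)%:R <= multiplicity h
       <= (u1 * u2 * u3)%:~R / (3`!)%:R).
Proof.
move=> D3h.
pose D : diagram := fun i j => (beta i j)%:R.
have D0 j : D 0%N j = (j == 0)%:R.
  by rewrite /D; case: hbeta => F hF ->; rewrite (tor_dim0 _ _ _ _ hI hF).
have [s hs3 D3] : exists2 s, D 3%N s != 0 & forall j, D 3%N j != 0 -> j = s.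
  case: hlevel => _ _ _ [s [s0 smin] [_ smax]].
  have nz j : D 3%N j != 0 <-> beta 3%N j <> 0%N.
    by rewrite /D pnatr_eq0; split => /eqP.
  exists s; first exact/nz.
  by move=> j /nz bj; apply/le_anti; rewrite smin ?smax.
have [m [a [x [y [hxy suma D4 D1 D2]]]]] := level_pure_decomposition D s hpure D0 D3.
have altE j : alt_coef 4 D j = if j is Posz m then D3h m else 0.
  case: hh => N DN ->.
  rewrite -(@alt_coef_widen N (maxn N 4)) ?leq_maxl // (@alt_coef_widen 4 (maxn N 4)) //.
  by rewrite leq_maxr.
have [u0 au0] : exists u, 0 < a u.
  apply/existsP; apply: contraT; rewrite negb_exists => /forallP na.
  move: suma; rewrite big_pred0 => [/eqP|u]; last exact: negbTE.
  by rewrite eq_sym oner_eq0.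
have s0 : 0 < s by case: (hxy _ au0) => ? ? ?; lia.
have D1z j : (forall u, 0 < a u -> j != x u) -> D 1%N j = 0.
  by move=> hj; rewrite D1 big1 // => u au; rewrite (negPf (hj u au)).
have D2z j : (forall u, 0 < a u -> j != y u) -> D 2%N j = 0.
  by move=> hj; rewrite D2 big1 // => u au; rewrite (negPf (hj u au)).
have pos_sum (g : 'I_m -> rat) (z : 'I_m -> int) v : 0 < a v ->
    (forall u, 0 < a u -> 0 < g u) ->
    0 < \sum_(u | 0 < a u) a u * g u *+ (z v == z u).
  move=> av gp; rewrite (bigD1 v) //= eqxx; apply: ltr_pwDl; first by rewrite mulr_gt0 ?gp.
  by apply: sumr_ge0 => u /andP [au _]; case: eqP; rewrite ?mulr1n // ltW ?mulr_gt0 ?gp.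
have D1x u : 0 < a u -> 0 < D 1%N (x u).
  move=> au; rewrite D1; apply: pos_sum => // v av; have [? ? ?] := hxy v av.
  by rewrite divr_gt0 ?mulr_gt0 ?ltr0z //; lia.
have D2y u : 0 < a u -> 0 < D 2%N (y u).
  move=> au; rewrite D2; apply: pos_sum => // v av; have [? ? ?] := hxy v av.
  by rewrite divr_gt0 ?mulr_gt0 ?ltr0z //; lia.
have D3z j : j != s -> D 3%N j = 0.
  by move=> js; apply/eqP; apply: contraNT js => /D3 ->.
have D12z j : j <= 0 \/ s <= j -> D 1%N j = 0 /\ D 2%N j = 0.
  move=> hj; split; [apply: D1z | apply: D2z] => u au;
    have [? ? ?] := hxy u au; apply/eqP => ?; lia.
have alt_out j : j < 0 \/ s < j -> alt_coef 4 D j = 0.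
  move=> hj; have [|d1 d2] := D12z j; first lia.
  have [j0 js] : j != 0 /\ j != s by split; apply/eqP; lia.
  by rewrite alt_coef4 D0 d1 d2 D3z // (negPf j0) !(subr0, addr0).
have alt_s : alt_coef 4 D s < 0.
  have [|d1 d2] := D12z s; first by right.
  rewrite alt_coef4 D0 d1 d2 gt_eqF // !(subr0, addr0) sub0r oppr_lt0 lt0r hs3.
  by rewrite /D ler0n.
have h0 : h != 0 by rewrite -size_poly_eq0 hc.
have q0 : (1 - 'X) ^+ 3 != 0 :> {poly rat} by rewrite -size_poly_eq0 polyseq_1subX3.
have sizeD3 : size ((1 - 'X) ^+ 3 * h) = (c + 4)%N.
  by rewrite size_mul // hc polyseq_1subX3 /=; lia.
(* Both sides are the degree of [(1 - 'X) ^+ 3 * h]: the alternating coefficient is nonzero at [s]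
   and zero beyond it. *)
have sE : s = Posz (c + 3).
  have : s <= (c + 3)%:Z.
    move: alt_s; rewrite altE; case: (s) => // i hi.
    rewrite lez_nat -ltnS -addnS; apply: contraTT hi; rewrite -leqNgt => hi.
    by rewrite /D3h nth_default ?ltxx // sizeD3.
  have : (c + 3)%:Z <= s.
    rewrite leNgt; apply/negP => hi.
    have := alt_out (Posz (c + 3)) (or_intror hi); rewrite altE => /eqP.
    have -> : D3h (c + 3)%N = lead_coef ((1 - 'X) ^+ 3 * h) 
      by rewrite /lead_coef sizeD3 (_ : (c + 4).-1 = c + 3)%N //; lia.
    by rewrite lead_coef_eq0 mulf_eq0 (negPf q0) (negPf h0).
  lia.
pose T := [seq Posz i | i <- iota 0 (c + 4)].
have uT : uniq T by rewrite map_inj_uniq ?iota_uniq // => i j [].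
have memT j : 0 <= j <= s -> j \in T.
  by case: j => // i hi; apply: map_f; rewrite mem_iota; lia.
have Tmem j : j \in T -> 0 <= j <= s.
  by move=> /mapP [i]; rewrite mem_iota => hi ->; lia.
have memT' j : 0 < j < s -> j \in T by move=> hj; apply: memT; lia.
have pairing mu := pure_combination_pairing _ _ _ _ _ _ mu _ hxy D0 D3 D1 D2 uT memT'.
(* The weight [(s - j) * j ^+ 2] is evaluated twice, through the h-vector and through the pure
   diagrams. *)
have eE : 6%:R * h.[1] = s%:~R * \sum_(u | 0 < a u) a u * ((x u)%:~R * (y u)%:~R).
  transitivity (s%:~R * \sum_(u | 0 < a u) a u * (((x u)%:~R * (y u)%:~R ^+ 2
       - (y u)%:~R * (x u)%:~R ^+ 2) / ((y u)%:~R - (x u)%:~R)) : rat); last first.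
    congr (_ * _); apply: eq_bigr => u au; congr (_ * _); have [_ xy _] := hxy u au.
    have d1 : (y u)%:~R - (x u)%:~R != 0 :> rat by rewrite subr_eq0 gt_eqF ?ltr_int.
    by field.
  rewrite -(pairing (fun j => j%:~R ^+ 2)) ?expr0n //.
  rewrite (h_vector_cubic_pairing h (alt_coef 4 D) _ T uT) //.
  - move=> j; apply: contraNT => jT; rewrite alt_out //.
    case: (ltP j 0) => hj; [by left | right].
    by rewrite ltNge; apply: contraNN jT => js; apply: memT; rewrite hj.
  - by move=> z; rewrite !rmorphB !rmorphD /=; ring.
have sR : 0 < s%:~R :> rat by rewrite ltr0z.
have sumc (z : rat) : \sum_(u | 0 < a u) a u * z = z by rewrite -mulr_suml suma mul1r.
have fact3 : (3`!)%:R = 6%:R :> rat by [].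
have lower (z : rat) : s%:~R * z <= 6%:R * h.[1] -> z * s%:~R / (3`!)%:R <= multiplicity h.
  by move=> hz; rewrite fact3 ler_pdivrMr // mulrC /multiplicity; lra.
have upper (z : rat) : 6%:R * h.[1] <= s%:~R * z -> multiplicity h <= z * s%:~R / (3`!)%:R.
  by move=> hz; rewrite fact3 ler_pdivlMr // /multiplicity; lra.
split.
  move=> n1 n2 N1 N2 [n1neg n1min] [[n2pos n2D] n2min] [[N1c N1neg] N1max] [N2pos N2max].
  (* At the least [x v] no [y w] can occur, since [y w > x w >= x v]. Row 1 therefore survives there
     and makes the coefficient negative. *)
  have hn1 u : 0 < a u -> n1%:Z <= x u.
    case: (@Order.TotalTheory.arg_minP _ _ _ u0 (fun u => 0 < a u) x au0) => v av vmin au.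
    apply: le_trans (vmin u au).
    have [x0 xy ys] := hxy v av.
    have : alt_coef 4 D (x v) < 0.
      have D2x : D 2%N (x v) = 0.
        apply: D2z => w aw; have [_ wxy _] := hxy w aw.
        by rewrite lt_eqF // (le_lt_trans (vmin w aw)).
      rewrite alt_coef4 D0 (gt_eqF x0) D2x D3z ?(lt_eqF (lt_trans xy ys)) //.
      by rewrite !(subr0, addr0) sub0r oppr_lt0 D1x.
    by rewrite altE; case: (x v) x0 => // i _ /n1min.
  (* Symmetrically, no [x w] reaches the greatest [y v], so the coefficient there is positive. *)
  have hN2 u : 0 < a u -> y u <= N2%:Z.
    case: (@Order.TotalTheory.arg_maxP _ _ _ u0 (fun u => 0 < a u) y au0) => v av vmax au.
    apply: le_trans (vmax u au) _.
    have [x0 xy ys] := hxy v av.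
    have : 0 < alt_coef 4 D (y v).
      have D1y : D 1%N (y v) = 0.
        apply: D1z => w aw; have [_ wxy _] := hxy w aw.
        by rewrite gt_eqF // (lt_le_trans wxy (vmax w aw)).
      rewrite alt_coef4 D0 (gt_eqF (lt_trans x0 xy)) D1y D3z ?(lt_eqF ys) //.
      by rewrite !(subr0, add0r) D2y.
    by rewrite altE; case: (y v) x0 xy => // i _ _ /N2max.
  have N2s : N2%:Z < s.
    rewrite ltNge le_eqVlt; apply/negP => /orP [/eqP sN2|sN2].
      by move: alt_s; rewrite sN2 altE => /lt_geF; rewrite ltW.
    by move: N2pos; have := altE (Posz N2); rewrite alt_out; [move=> <-; rewrite ltxx|right].
  have bump0 (A B : nat) : bump_weight A%:R B%:R 0 = 0.
    by rewrite /bump_weight max_l // sub0r subr0 mulNr oppr_le0 mulr_ge0.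
  have bump_pos (A B : nat) (j : int) : 0 < bump_weight A%:R B%:R j%:~R ->
      A%:Z < j < B%:Z \/ B%:Z < j < A%:Z.
    rewrite -[A%:R]/((Posz A)%:~R) -[B%:R]/((Posz B)%:~R) => /bump_weight_gt0.
    by rewrite !ltr_int.
  have bump_ge0 A B z : 0 <= bump_weight A B z by rewrite /bump_weight le_max lexx.
  (* Below [n1] row 2 vanishes, and in positive degrees row 0 does too. What remains enters with a
     minus sign, so no coefficient there is positive. *)
  have n12 : (n1 <= n2)%N.
    rewrite leqNgt; apply/negP => n21.
    have := altE (Posz n2); rewrite alt_coef4 D0 D2z => [e|u au]; last first.
      have [_ xy _] := hxy u au; rewrite lt_eqF // (lt_trans _ xy) //.
      by rewrite (lt_le_trans _ (hn1 u au)) // ltz_nat.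
    have : D 1%N n2%:Z >= 0 /\ D 3%N n2%:Z >= 0 by rewrite !ler0n.
    move: n2D; rewrite -e gt_eqF ?ltz_nat // -[false%:R]/(0 : rat) => p [].
    by clear -p; lra.
  (* Above [N2] row 1 vanishes, and [N1 <= c + 1] keeps [N1] off the row 3 degree [c + 3]. Only
     nonnegative contributions would be left. *)
  have N12 : (N1 <= N2)%N.
    rewrite leqNgt; apply/negP => N21.
    have := altE (Posz N1); rewrite alt_coef4 D0 D1z => [|u au]; last first.
      have [_ xy _] := hxy u au; rewrite gt_eqF // (lt_trans xy) //.
      by rewrite (le_lt_trans (hN2 u au)) // ltz_nat.
    rewrite D3z => [e|]; last by rewrite sE eqz_nat ltn_eqF // (leq_ltn_trans N1c) // ltn_add2l.
    have : D 2%N N1%:Z >= 0 by exact: ler0n.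
    have : (Posz N1 == 0)%:R >= 0 :> rat by exact: ler0n.
    by move: N1neg; rewrite -e; clear; lra.
  apply/andP; split.
    rewrite natrM -[(c + 3)%:R]/((Posz (c + 3))%:~R) -sE; apply: lower.
    rewrite eE ler_pM2l // -[X in X <= _]sumc natrM.
    have := pairing (fun j => bump_weight n1%:R n2%:R j%:~R) (bump0 n1 n2).
    set W := (X in _ = _ * X) => WE.
    have W0 : W <= 0.
      rewrite -(pmulr_rle0 _ sR) -WE big_seq; apply: sumr_le0 => j /Tmem /andP [j0 js].
      have := bump_ge0 n1%:R n2%:R j%:~R.
      rewrite le_eqVlt => /orP [/eqP <-|bp]; first by rewrite !mulr0.
      rewrite mulr_le0_ge0 // ?mulr_ge0 ?ler0z ?subr_ge0 ?(ltW bp) //.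
      rewrite altE; case: j j0 js bp => // i _ _ /bump_pos [];
        rewrite !ltz_nat => /andP [lo hi]; last first.
        by have := ltn_trans lo hi; rewrite ltnNge n12.
      rewrite leNgt; apply/negP => pi; move: hi; rewrite ltnNge => /negP; apply.
      by apply: n2min; split; first exact: leq_ltn_trans lo.
    (* Termwise comparison bounds the average of [n1 * n2 - x u * y u] above by [W], hence by 0. *)
    rewrite -subr_le0; apply: le_trans W0; rewrite -sumrB; apply: ler_sum => u au.
    have [x0 xy ys] := hxy u au.
    rewrite -mulrBr ler_pM2l //; apply: bump_weight_lower; rewrite ?ler0n ?ltr0z ?ltr_int //.
    by rewrite -[n1%:R]/((Posz n1)%:~R) ler_int hn1.
  rewrite natrM -[(c + 3)%:R]/((Posz (c + 3))%:~R) -sE; apply: upper.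
  rewrite eE ler_pM2l // -[X in _ <= X]sumc natrM.
  have := pairing (fun j => bump_weight N1%:R N2%:R j%:~R) (bump0 N1 N2).
  set W := (X in _ = _ * X) => WE.
  have W0 : 0 <= W.
    rewrite -(pmulr_rge0 _ sR) -WE big_seq; apply: sumr_ge0 => j /Tmem /andP [j0 js].
    have := bump_ge0 N1%:R N2%:R j%:~R.
    rewrite le_eqVlt => /orP [/eqP <-|bp]; first by rewrite !mulr0.
    rewrite mulr_ge0 // ?mulr_ge0 ?ler0z ?subr_ge0 ?(ltW bp) //.
    rewrite altE; case: j j0 js bp => // i _ _ /bump_pos [];
      rewrite !ltz_nat => /andP [lo hi]; last first.
      by have := ltn_trans lo hi; rewrite ltnNge N12.
    rewrite leNgt; apply/negP => pi; move: lo; rewrite ltnNge => /negP; apply.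
    (* From [i < N2 < c + 3] follows [i <= c + 1], which is the range in which [N1] is maximal. *)
    apply: N1max; split=> //; move: N2s; rewrite sE ltz_nat; clear -hi; lia.
  rewrite -subr_ge0; apply: le_trans W0 _; rewrite -sumrB; apply: ler_sum => u au.
  have [x0 xy ys] := hxy u au.
  rewrite -mulrBr ler_pM2l //; apply: bump_weight_upper; rewrite ?ler0n ?ltr0z ?ltr_int //.
  by rewrite -[N2%:R]/((Posz N2)%:~R) ler_int hN2.
move=> l1 l2 l3 u1 u2 u3 [l1b l1min] [l2b l2min] [l3b _] [u1b u1max] [u2b u2max] [u3b _].
have nz i j : D i j != 0 <-> beta i j <> 0%N by rewrite /D pnatr_eq0; split => /eqP.
have -> : l3 = s by apply/D3/nz.
have -> : u3 = s by apply/D3/nz.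
have l10 : 0 < l1.
  have : D 1%N l1 != 0 by exact/nz.
  by apply: contraNT; rewrite -leNgt => l1n; have [-> _] := D12z l1 (or_introl l1n).
have l20 : 0 < l2.
  have : D 2%N l2 != 0 by exact/nz.
  by apply: contraNT; rewrite -leNgt => l2n; have [_ ->] := D12z l2 (or_introl l2n).
(* Each [x u] and [y u] is an actual shift, so every product [x u * y u] lies between the products
   of extreme shifts, and so does their weighted average. *)
have xnz u : 0 < a u -> beta 1%N (x u) <> 0%N by move=> /D1x /lt0r_neq0 /nz.
have ynz u : 0 < a u -> beta 2%N (y u) <> 0%N by move=> /D2y /lt0r_neq0 /nz.
rewrite (intrM _ (l1 * l2) s) (intrM _ (u1 * u2) s); apply/andP; split.
  apply: lower; rewrite eE ler_pM2l // -[X in X <= _]sumc.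
  apply: ler_sum => u au; rewrite ler_pM2l // -intrM ler_int.
  by apply: ler_pM; rewrite ?(ltW l10) ?(ltW l20) // ?l1min ?l2min; auto.
apply: upper; rewrite eE ler_pM2l // -[X in _ <= X]sumc.
apply: ler_sum => u au; rewrite ler_pM2l // -intrM ler_int.
have [x0 xy _] := hxy u au.
by apply: ler_pM; rewrite ?(ltW x0) ?(ltW (lt_trans x0 xy)) // ?u1max ?u2max; auto.
Qed.
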